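(* Let $r\ge 1$ be an integer. There exists a constant $\widehat{C}_r>0$, independent of $n$ and depending only on $r$, such that for every $g\in C^{r+1}[c,d]$, $$\|\widetilde{T}_{n,r}(g)-g\|_\infty\le \widehat{C}_r\,h_n^{\,r+1}\,\|g^{(r+1)}\|_\infty,$$ where $h_n:=\max_{0\le k\le n-1}(z_{k+1}-z_k)$ is the mesh norm of the irregular grid $\{z_k\}_{k=0}^n$ on which the operator $\widetilde{T}_{n,r}$ is built.
   Context: Setting. $[c,d]\subset\mathbb{R}$ is a compact interval, functions are real-valued, $\|g\|_\infty=\max_{y\in[c,d]}|g(y)|$, and $C^{s}[c,d]$ is the space of functions whose derivatives up to order $s$ exist and are continuous on $[c,d]$. Irregular grid. $c=z_0<z_1<\cdots<z_n=d$ is a partition with $0<d_1\le z_{k+1}-z_k\le d_2$ for $k=0,\dots,n-1$, where $d_2<2d_1$; here $d_1=\min_k(z_{k+1}-z_k)$ is the minimum mesh size. Activation. For $m>0$, $D(m)$ is the class of measurable functions $\eta:\mathbb{R}\to\mathbb{R}$ that are increasing (i.e. non-decreasing), with $\eta(y)=0$ for $y\le -m$, $\eta(y)=1$ for $y\ge m$, and $0<\eta(y)<1$ for $-m<y<m$. Fix $\eta\in D(m)$ and put $\sigma(y):=\eta(y+m)-\eta(y-m)$, $y\in\mathbb{R}$. Operator. For $g\in C^r[c,d]$ let $P_r(g;y,z_k):=\sum_{j=0}^{r}\frac{g^{(j)}(z_k)}{j!}(y-z_k)^j$ and $$\widetilde{T}_{n,r}(g,y):=\frac{\sum_{k=0}^{n}\sigma\!\left(\frac{2m}{d_1}(y-z_k)\right)P_r(g;y,z_k)}{\sum_{k=0}^{n}\sigma\!\left(\frac{2m}{d_1}(y-z_k)\right)},\qquad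 y\in[c,d].$$ $\widetilde{T}_{n,r}(g)$ denotes the function $y\mapsto\widetilde{T}_{n,r}(g,y)$. *)

(* Defs.v *)
From HB Require Import structures.
From mathcomp Require Import all_boot all_order all_algebra.
From mathcomp Require Import all_classical all_reals all_analysis.

Set Implicit Arguments.
Unset Strict Implicit.
Unset Printing Implicit Defensive.

Import Order.TTheory GRing.Theory Num.Theory.
Import numFieldNormedType.Exports.

Local Open Scope classical_set_scope.
Local Open Scope ring_scope.

(* A function on [c, d] is represented by any of its extensions to R.  The
   derivative is that of the restriction to [c, d], hence one-sided at c and d;
   the values outside [c, d] are never used. *)

Definition diff_quotient (R : realType) (f : R -> R) (x y : R) : R :=
  (f y - f x) / (y - x).

Definition derivable_on (R : realType) (c d : R) (f : R -> R) (x : R) : Prop :=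
  cvg (diff_quotient f x y @[y --> within `[c, d] x^']).

Definition derive_on (R : realType) (c d : R) (f : R -> R) (x : R) : R :=
  lim (diff_quotient f x y @[y --> within `[c, d] x^']).

Definition derive_on_n (R : realType) (c d : R) (j : nat) (f : R -> R) :
  R -> R := iter j (@derive_on R c d) f.

Definition class_C (R : realType) (c d : R) (s : nat) (f : R -> R) : Prop :=
  (forall j x, (j < s)%N -> x \in `[c, d] ->
     derivable_on c d (derive_on_n c d j f) x) /\
  (forall j, (j <= s)%N -> {within `[c, d], continuous (derive_on_n c d j f)}).

(* Taken in \bar R, so that the norm of an unbounded function is +oo.  A
   supremum rather than a maximum: the operator below need not be continuous
   when eta is not. *)
Definition sup_norm (R : realType) (c d : R) (f : R -> R) : \bar R :=
  ereal_sup [set (`|f y|)%:E | y in `[c, d]].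

(* A grid z_0, ..., z_n is given by a sequence of which only the terms of
   index at most n matter. *)

Definition mesh_norm (R : realType) (n : nat) (z : nat -> R) : R :=
  \big[Num.max/0]_(k < n) (z k.+1 - z k).

(* Meaningful for n > 0, where the default value z_1 - z_0 is itself a mesh
   size. *)
Definition min_mesh (R : realType) (n : nat) (z : nat -> R) : R :=
  \big[Num.min/z 1%N - z 0%N]_(k < n) (z k.+1 - z k).

Record irregular_grid (R : realType) (c d : R) (n : nat) (z : nat -> R)
    (d1 d2 : R) : Prop := {
  grid_size : (0 < n)%N;
  grid_first : z 0%N = c;
  grid_last : z n = d;
  grid_min : d1 = min_mesh n z;
  grid_min_gt0 : 0 < d1;
  grid_step : forall k, (k < n)%N -> d1 <= z k.+1 - z k <= d2;
  grid_ratio : d2 < 2 * d1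
}.

Record class_D (R : realType) (m : R) (eta : R -> R) : Prop := {
  classD_measurable : measurable_fun [set: R] eta;
  classD_incr : {homo eta : x y / x <= y};
  classD_left : forall y : R, y <= - m -> eta y = 0;
  classD_right : forall y : R, m <= y -> eta y = 1;
  classD_mid : forall y : R, - m < y < m -> 0 < eta y < 1
}.

Definition sigma (R : realType) (m : R) (eta : R -> R) (y : R) : R :=
  eta (y + m) - eta (y - m).

Definition taylor_poly (R : realType) (c d : R) (r : nat) (g : R -> R)
    (y x : R) : R :=
  \sum_(0 <= j < r.+1) derive_on_n c d j g x / j`!%:R * (y - x) ^+ j.

Definition T_op (R : realType) (c d m d1 : R) (eta : R -> R) (n : nat)
    (z : nat -> R) (r : nat) (g : R -> R) (y : R) : R :=
  (\sum_(0 <= k < n.+1)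
     sigma m eta (2 * m / d1 * (y - z k)) * taylor_poly c d r g y (z k)) /
  (\sum_(0 <= k < n.+1) sigma m eta (2 * m / d1 * (y - z k))).

(* Main.v *)
Require Import Defs.
From HB Require Import structures.
From mathcomp Require Import all_boot all_order all_algebra.
From mathcomp Require Import all_classical all_reals all_analysis.
From mathcomp Require Import ring lra.

Import Order.TTheory GRing.Theory Num.Theory.
Import numFieldNormedType.Exports.

Local Open Scope classical_set_scope.
Local Open Scope ring_scope.

(* sigma vanishes outside ]-2m, 2m[ and is positive inside, so exactly the
   nodes z_k with |y - z_k| < d1 contribute to the operator at y; since
   d2 < 2 * d1 there is such a node.  Hence T(g, y) is a convex combination of
   the values at y of Taylor polynomials of g centred within d1 <= h_n of y.
   Iterating the mean value theorem, without tracking the factor 1/(r+1)!, each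
   of them differs from g(y) by at most ||g^(r+1)|| h_n^(r+1), so that the
   constant 1 works. *)

(** Differentiation shifts the coefficients: with [a j] the derivatives of [g] at [x], the
    derivative of a Taylor sum of [g] is the shorter Taylor sum of its derivative. This is what
    drives the induction in [norm_taylor_sub_le]. *)
Lemma is_derive_taylor_sum {R : realType} {a : nat -> R} {s : nat} {x y : R} :
  is_derive y 1 (fun t => \sum_(0 <= j < s.+1) a j / j`!%:R * (t - x) ^+ j)
    (\sum_(0 <= j < s) a j.+1 / j`!%:R * (y - x) ^+ j).
Proof.
elim: s => [|s IHs].
  under eq_fun do rewrite big_nat1 expr0.
  by rewrite big_geq//; exact: is_derive_cst.
under eq_fun do rewrite big_nat_recr//=.
rewrite big_nat_recr//=; apply: is_deriveD.
have dX : is_derive y 1 (fun t => t - x) 1.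
  by apply: is_derive_eq; rewrite ?subr0.
have -> : (fun t => a s.+1 / (s.+1)`!%:R * (t - x) ^+ s.+1) =
    (a s.+1 / (s.+1)`!%:R) \*: ((fun t => t - x) ^+ s.+1).
  by apply/funext => t; rewrite exprfctE.
apply: is_derive_eq.
rewrite /GRing.scale/= mulr1 factS natrM.
have s0 : (s.+1%:R : R) != 0 by rewrite pnatr_eq0.
have f0 : (s`!%:R : R) != 0 by rewrite pnatr_eq0 -lt0n fact_gt0.
by field; rewrite f0 addrC natr1.
Qed.

(** Near an interior point, restricting to [[c, d]] does not change the punctured neighbourhoods, so
    the derivative relative to the interval is the ordinary one and the mean value theorem becomes
    available. *)
Lemma is_derive_derive_on (R : realType) (c d : R) (f : R -> R) (x : R) :
  x \in `]c, d[ -> derivable_on c d f x -> is_derive x 1 f (derive_on c d f x).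
Proof.
rewrite in_itv/= => /andP[cx xd] fx.
have shift_x : h + x @[h --> 0^'] --> within `[c, d] x^'.
  move=> U /nbhs_ballP[e/= e0 xU].
  (* A radius of at most [x - c] and [d - x] keeps [h + x] inside [[c, d]]. *)
  have e'0 : 0 < Num.min e (Num.min (x - c) (d - x)) by rewrite !lt_min; lra.
  apply/nbhs_ballP; exists (Num.min e (Num.min (x - c) (d - x))) => //= h.
  rewrite /ball/= sub0r normrN !lt_min !ltr_norml => /and3P[he hc hd] h0.
  apply: xU.
  - by rewrite /ball/= ltr_norml; lra.
  - by apply: contra h0 => /eqP ?; apply/eqP; lra.
  - by rewrite in_itv/=; lra.
have dq : h^-1 *: ((f \o shift x) (h *: 1) - f x) @[h --> 0^'] -->
    derive_on c d f x.
  rewrite (_ : (fun _ => _) = diff_quotient f x \o (fun h => h + x)).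
    by apply: cvg_comp shift_x _; exact: fx.
  apply/funext => h.
  by rewrite /diff_quotient/= /GRing.scale/= mulr1 addrK mulrC.
by apply: DeriveDef; [exact/cvgP/dq|exact: cvg_lim dq].
Qed.

(** The node may lie on either side of the evaluation point, so [u] and [v] come in any order. The
    bound on [|w - u|] is what later replaces powers of [|w - x|] by powers of [|y - x|]. *)
Lemma mean_value_on {R : realType} {c d : R} {f df : R -> R} {u v : R} :
  {within `[c, d], continuous f} ->
  (forall x, x \in `]c, d[ -> is_derive x 1 f (df x)) ->
  u \in `[c, d] -> v \in `[c, d] ->
  exists w, [/\ w \in `[c, d], `|w - u| <= `|v - u| &
                f v - f u = df w * (v - u)].
Proof.
move=> fc fd; rewrite !in_itv/= => /andP[cu ud] /andP[cv vd].
have mvt (a b : R) : c <= a -> b <= d -> a <= b ->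
    exists2 w, w \in `[a, b] & f b - f a = df w * (b - a).
  move=> ca bd ab.
  have fd_ab x : x \in `]a, b[ -> is_derive x 1 f (df x).
    rewrite in_itv/= => /andP[ax xb]; apply: fd.
    by rewrite in_itv/= (le_lt_trans ca) ?(lt_le_trans xb).
  have fc_ab : {within `[a, b], continuous f}.
    apply: continuous_subspaceW fc => x /=.
    rewrite !in_itv/= => /andP[ax xb].
    by rewrite (le_trans ca) ?(le_trans xb).
  exact: MVT_segment ab fd_ab fc_ab.
have [uv|/ltW vu] := leP u v.
  have [w] := mvt _ _ cu vd uv.
  rewrite in_itv/= => /andP[uw wv] e; exists w; split => //.
    by rewrite in_itv/= (le_trans cu) ?(le_trans wv).
  by rewrite !ger0_norm ?subr_ge0// lerB.
have [w] := mvt _ _ cv ud vu.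
rewrite in_itv/= => /andP[vw wu] e; exists w; split.
- by rewrite in_itv/= (le_trans cv) ?(le_trans wu).
- by rewrite !ler0_norm ?subr_le0// lerN2 lerB.
- by rewrite -opprB e -mulrN opprB.
Qed.

(** Induction on [s] with [g] varying: the error [P - g] vanishes at [x], and its derivative is the
    error of one order less for the derivative [g1]. Each use of the mean value theorem thus
    contributes one factor [|y - x|]. *)
Lemma norm_taylor_sub_le {R : realType} {c d : R} {s : nat} {g : R -> R}
    {M x y : R} :
  class_C c d s g ->
  (forall t, t \in `[c, d] -> `|derive_on_n c d s g t| <= M) ->
  x \in `[c, d] -> y \in `[c, d] ->
  `|\sum_(0 <= j < s) derive_on_n c d j g x / j`!%:R * (y - x) ^+ j - g y|
    <= M * `|y - x| ^+ s.
Proof.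
move=> + + xcd; elim: s g y => [|s IHs] g y [gd gc] gM ycd.
  by rewrite big_geq// sub0r normrN expr0 mulr1 gM.
set g1 := derive_on c d g.
have g1n j : derive_on_n c d j.+1 g = derive_on_n c d j g1.
  by rewrite /derive_on_n iterSr.
pose P t := \sum_(0 <= j < s.+1) derive_on_n c d j g x / j`!%:R * (t - x) ^+ j.
pose dP t := \sum_(0 <= j < s) derive_on_n c d j.+1 g x / j`!%:R * (t - x) ^+ j.
have P_derive (t : R) : is_derive t 1 P (dP t).
  exact: (is_derive_taylor_sum (a := fun j => derive_on_n c d j g x)).
have F_cont : {within `[c, d], continuous (P - g)}.
  apply: within_continuousB; last exact: (gc 0%N).
  by apply: derivable_within_continuous => t _; exact: ex_derive.
have F_derive (t : R) : t \in `]c, d[ -> is_derive t 1 (P - g) (dP t - g1 t).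
  move=> tcd; apply: is_deriveB.
  apply: is_derive_derive_on => //; apply: (gd 0%N) => //.
  exact: subset_itv_oo_cc.
have [w [wcd wx]] := mean_value_on F_cont F_derive xcd ycd.
have -> : (P - g) x = 0.
  rewrite -[LHS]/(P x - g x) /P big_nat_recl//= expr0 fact0 divr1 mulr1.
  (* At the centre only the constant term [g x] survives. *)
  rewrite big1 ?addr0 ?subrr//.
  by move=> j _; rewrite expr0n mulr0.
rewrite subr0 => Fy; rewrite -[leLHS]/(`|(P - g) y|) Fy normrM exprSr mulrA.
rewrite ler_wpM2r//.
have : `|dP w - g1 w| <= M * `|w - x| ^+ s.
  rewrite /dP; under eq_bigr do rewrite g1n.
  apply: IHs => //; last by move=> t tcd; rewrite -g1n gM.
  by split=> j; rewrite -g1n => *; [exact: gd|exact: gc].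
move/le_trans; apply; rewrite ler_wpM2l ?lerXn2r ?nnegrE//.
exact: le_trans (gM _ xcd).
Qed.

Lemma sigma_ge0 (R : realType) (m : R) (eta : R -> R) (u : R) :
  0 < m -> class_D m eta -> 0 <= sigma m eta u.
Proof. by move=> m0 [_ mono _ _ _]; rewrite subr_ge0; apply: mono; lra. Qed.

(** For [u <= 0] the subtracted term is 0 and [u + m > - m] makes the other positive; for [u > 0]
    the first term is 1 and [u - m < m] keeps the other below 1. *)
Lemma sigma_gt0 (R : realType) (m : R) (eta : R -> R) (u : R) :
  class_D m eta -> `|u| < 2 * m -> 0 < sigma m eta u.
Proof.
move=> [_ _ L Rr M]; rewrite ltr_norml => /andP[lu ru]; rewrite subr_gt0.
have [u0|u0] := lerP u 0.
  rewrite (L (u - m)); last lra.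
  have [um|um] := ltrP (u + m) m; last by rewrite Rr.
  by have /andP[] : 0 < eta (u + m) < 1 by apply: M; lra.
rewrite (Rr (u + m)); last lra.
by have /andP[] : 0 < eta (u - m) < 1 by apply: M; lra.
Qed.

(** Both [u + m] and [u - m] lie on the same plateau of [eta]. *)
Lemma sigma_eq0 {R : realType} {m : R} {eta : R -> R} {u : R} :
  0 < m -> class_D m eta -> 2 * m <= `|u| -> sigma m eta u = 0.
Proof.
move=> m0 [_ _ L Rr _]; rewrite /sigma ler_normr => /orP[]mu.
  by rewrite !Rr ?subrr//; lra.
by rewrite !L ?subrr//; lra.
Qed.

Lemma grid_cell {R : realType} {z : nat -> R} {n : nat} {y : R} :
  (0 < n)%N -> z 0%N <= y <= z n ->
  exists2 k, (k < n)%N & z k <= y <= z k.+1.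
Proof.
elim: n => // -[_ _|n IHn _] /andP[zy yz].
  by exists 0%N => //; apply/andP.
have [yn|yn] := leP y (z n.+1).
  by have [|k kn ?] := IHn erefl; [exact/andP|exists k => //; exact: ltnW].
by exists n.+1 => //; rewrite yz ltW.
Qed.

Lemma grid_in {R : realType} {c d d1 d2 : R} {n k : nat} {z : nat -> R} :
  irregular_grid c d n z d1 d2 -> (k <= n)%N -> z k \in `[c, d].
Proof.
move=> [_ <- <- _ d10 st _] kn.
have mono i j : (i <= j <= n)%N -> z i <= z j.
  elim: j => [|j IHj]; first by rewrite leqn0 => /andP[/eqP->].
  rewrite leq_eqVlt => /andP[/orP[/eqP->//|ij] jn].
  rewrite (le_trans (IHj _)) ?(ltnW jn) ?andbT//.
  by have /andP[? _] := st _ jn; lra.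
by rewrite in_itv/= !mono//= ?kn ?leqnn.
Qed.

Lemma norm_T_op_sub_le {R : realType} {c d m d1 d2 : R} {eta : R -> R} {n : nat}
    {z : nat -> R} {r : nat} {g : R -> R} {M y : R} :
  irregular_grid c d n z d1 d2 -> 0 < m -> class_D m eta ->
  class_C c d r.+1 g ->
  (forall t, t \in `[c, d] -> `|derive_on_n c d r.+1 g t| <= M) ->
  y \in `[c, d] ->
  `|T_op c d m d1 eta n z r g y - g y| <= M * d1 ^+ r.+1.
Proof.
move=> zgrid m0 etaD gC gM ycd.
have [n0 z0 zn _ d10 step ratio] := zgrid.
have M0 : 0 <= M by exact: le_trans (gM _ ycd).
rewrite /T_op; set w := fun k => sigma m eta (2 * m / d1 * (y - z k)).
rewrite -/(w _).
have w0 k : 0 <= w k by exact: sigma_ge0.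
have normw k : `|2 * m / d1 * (y - z k)| = 2 * m / d1 * `|y - z k|.
  by rewrite normrM ger0_norm// divr_ge0 ?mulr_ge0// ltW.
have W0 : 0 < \sum_(0 <= k < n.+1) w k.
  have [k kn yk] : exists2 k, (k <= n)%N & `|y - z k| < d1.
    have [|k kn /andP[zky yzk]] := grid_cell (z := z) (y := y) n0.
      by rewrite z0 zn; move: ycd; rewrite in_itv.
    have /andP[_ stepk] := step k kn.
    have [ylt|yge] := ltrP (y - z k) d1.
      by exists k; rewrite ?ger0_norm ?subr_ge0// ltnW.
    (* Here [y] is at least [d1] to the right of [z k], so its distance to the next node is at most
       [d2 - d1 < d1]. *)
    exists k.+1 => //; rewrite ler0_norm ?subr_le0//.
    move: ratio stepk yge; clear; lra.
  rewrite (bigD1_seq k) ?iota_uniq ?mem_index_iota//=.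
  rewrite ltr_pwDl ?sumr_ge0// sigma_gt0// normw.
  by rewrite -mulrA gtr_pMr ?mulr_gt0// mulrC ltr_pdivrMr ?mul1r.
(* Writing [g y] as its own weighted mean turns the error into a weighted mean of the Taylor
   errors. *)
rewrite -[X in _ - X](mulfK (lt0r_neq0 W0)) -mulrBl.
rewrite normrM normfV (gtr0_norm W0).
rewrite ler_pdivrMr// mulr_sumr mulr_sumr -sumrB.
rewrite (le_trans (ler_norm_sum _ _ _))//.
rewrite !big_nat; apply: ler_sum => k kn.
rewrite [X in _ - X]mulrC -mulrBr normrM (ger0_norm (w0 k)) [leRHS]mulrC.
(* The factor [2 * m / d1] maps distance [d1] to the edge [2 * m] of the support of [sigma], so far
   nodes have weight zero. *)
have [yk|yk] := ltrP `|y - z k| d1; last first.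
  suff -> : w k = 0 by rewrite !mul0r.
  apply: sigma_eq0 => //.
  rewrite normw -mulrA ler_peMr ?mulr_ge0 ?(ltW m0)//.
  by rewrite mulrC ler_pdivlMr ?mul1r.
rewrite ler_wpM2l//.
apply: le_trans (norm_taylor_sub_le gC gM (grid_in zgrid kn) ycd) _.
by rewrite ler_wpM2l// lerXn2r ?nnegrE ?(ltW d10) ?(ltW yk).
Qed.

Lemma irregular_grid_le_mesh_norm {R : realType} {c d d1 d2 : R} {n : nat}
    {z : nat -> R} :
  irregular_grid c d n z d1 d2 -> d1 <= mesh_norm n z.
Proof.
move=> [n0 _ _ _ _ /(_ _ n0)/andP[d1z _] _]; apply: le_trans d1z _.
exact: (le_bigmax 0 (fun k : 'I_n => z k.+1 - z k) (Ordinal n0)).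
Qed.

Theorem corollary2p8 (R : realType) (r : nat) (hr : (1 <= r)%N) :
  exists C : R, 0 < C /\
    forall (c d : R) (n : nat) (z : nat -> R) (d1 d2 m : R) (eta g : R -> R),
      c < d ->
      irregular_grid c d n z d1 d2 ->
      0 < m ->
      class_D m eta ->
      class_C c d r.+1 g ->
      (sup_norm c d (fun y => T_op c d m d1 eta n z r g y - g y)%R
       <= (C * mesh_norm n z ^+ r.+1)%:E
          * sup_norm c d (derive_on_n c d r.+1 g))%E.
Proof.
exists 1; split=> // c d n z d1 d2 m eta g cd zgrid m0 etaD gC; rewrite mul1r.
have d10 := grid_min_gt0 zgrid.
have d1h := irregular_grid_le_mesh_norm zgrid.
have h0 := lt_le_trans d10 d1h.
have gsup t : t \in `[c, d] ->
    (`|derive_on_n c d r.+1 g t|%:E <= sup_norm c d (derive_on_n c d r.+1 g))%E.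
  by move=> tcd; apply: ereal_sup_ubound; exists t.
have cc : c \in `[c, d] by rewrite in_itv/= lexx ltW.
have gc := gsup c cc.
(* An infinite norm makes the right-hand side [+oo], the factor [mesh_norm n z ^+ r.+1] being
   positive; [-oo] is excluded by the value at [c]. *)
case supE : (sup_norm c d (derive_on_n c d r.+1 g)) => [M| |].
- apply: ge_ereal_sup => _ [y ycd <-]; rewrite -EFinM lee_fin mulrC.
  have gM t : t \in `[c, d] -> `|derive_on_n c d r.+1 g t| <= M.
    by move=> /gsup; rewrite supE lee_fin.
  apply: le_trans (norm_T_op_sub_le zgrid m0 etaD gC gM ycd) _.
  rewrite ler_wpM2l ?(le_trans _ (gM c cc))//.
  by rewrite lerXn2r ?nnegrE ?(ltW d10) ?(ltW h0).
- by rewrite mulry gtr0_sg ?exprn_gt0// mul1e leey.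
- by move: gc; rewrite supE.
Qed.
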